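(* Let $J$ be a positive integer. (1) (Two-factor model.) Let $$\Theta = \left\{ \boldsymbol\theta = (\delta_1,\dots,\delta_J, a_{11},\dots,a_{J1},a_{22},\dots,a_{J2})^\top \in\mathbb{R}^{3J-1}:\ \delta_j >0,\ j=1,\dots,J \right\},$$ and for $\boldsymbol\theta\in\Theta$ let $P_{\boldsymbol\theta}$ be the $J$-variate normal distribution $N(\mathbf 0,\boldsymbol\Sigma)$ with $$\boldsymbol\Sigma = \mathbf a_1\mathbf a_1^\top + \mathbf a_2\mathbf a_2^\top + \boldsymbol\Delta,$$ where $\mathbf a_1=(a_{11},\dots,a_{J1})^\top$, $\mathbf a_2 = (a_{12},a_{22},\dots,a_{J2})^\top$ with $a_{12}=0$ fixed, and $\boldsymbol\Delta=\mathrm{diag}(\delta_1,\dots,\delta_J)$. If the true parameter vector $\boldsymbol\theta^*\in\Theta$ satisfies $a^*_{j2}=0$ for $j=2,\dots,J$, then the Fisher information matrix $I(\boldsymbol\theta^* )$ is non-invertible. (2) (Two-factor item factor analysis model.) Let $\Theta=\mathbb{R}^{3J-1}$, with elements written as $\boldsymbol\theta=(d_1,\dots,d_J,a_{11},\dots,a_{J1},a_{22},\dots,a_{J2})^\top$, and for $\boldsymbol\theta\in\Theta$ let $P_{\boldsymbol\theta}$ be the distribution on $\{0,1\}^J$ with probability mass function $$\pi_{\mathbf x} = \int\!\!\int \prod_{j=1}^J \frac{\exp(x_j(d_j + a_{j1}\xi_1 + a_{j2}\xi_2))}{1+\exp(d_j + a_{j1}\xi_1 + a_{j2}\xi_2)}\,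 \phi(\xi_1)\phi(\xi_2)\,d\xi_1d\xi_2,\qquad \mathbf x = (x_1,\dots,x_J)^\top\in\{0,1\}^J,$$ where $a_{12}=0$ is fixed and $\phi$ is the standard normal probability density function. If the true parameter vector $\boldsymbol\theta^*\in\Theta$ satisfies $a^*_{j2}=0$ for $j=2,\dots,J$, then the Fisher information matrix $I(\boldsymbol\theta^* )$ is non-invertible.
   Context: For i.i.d. observations $\mathbf X_1,\dots,\mathbf X_N$ from a parametric model $\{P_{\boldsymbol\theta}:\boldsymbol\theta\in\Theta\}$ with densities $p_{\boldsymbol\theta}$ with respect to a common $\sigma$-finite measure (Lebesgue measure on $\mathbb{R}^J$ in part (1), counting measure on $\{0,1\}^J$ in part (2)), the log-likelihood is $l_N(\boldsymbol\theta)=\sum_{i=1}^N\log p_{\boldsymbol\theta}(\mathbf X_i)$. The (expected) Fisher information matrix at $\boldsymbol\theta^*$ is $$I(\boldsymbol\theta^* ) = \frac1N E_{\boldsymbol\theta^*}\left[\nabla l_N(\boldsymbol\theta^* )\,\nabla l_N(\boldsymbol\theta^* )^\top\right],$$ i.e. the matrix with $(i,j)$ entry $E_{\boldsymbol\theta^*}\left[\frac{\partial \log p_{\boldsymbol\theta}(\mathbf X_1)}{\partial\theta_i}\Big|_{\boldsymbol\theta^*}\frac{\partial \log p_{\boldsymbol\theta}(\mathbf X_1)}{\partial\theta_j}\Big|_{\boldsymbol\theta^*}\right]$, where the expectation is under $P_{\boldsymbol\theta^*}$ and the gradient is taken with respect to the $3J-1$ free parameters. Starred quantities $a^*_{jk}$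 etc. denote the corresponding components of $\boldsymbol\theta^*$. *)

(* Defs.v *)
From HB Require Import structures.
From mathcomp Require Import all_boot all_order all_algebra.
From mathcomp Require Import all_classical all_reals all_analysis.

Set Implicit Arguments.
Unset Strict Implicit.
Unset Printing Implicit Defensive.

Import Order.TTheory GRing.Theory Num.Theory.
Import numFieldNormedType.Exports.

Local Open Scope classical_set_scope.
Local Open Scope ring_scope.

(* Lebesgue measure on R^n, with R^n represented as n.-tuple R equipped with  *)
(* the product sigma-algebra: the image of the iterated product measure under *)
(* (x, y) |-> x :: y.                                                         *)
Section lebesgue_tuple.
Context {R : realType}.
Local Notation mR := (measurableTypeR R).

Definition cons_pair n (u : mR * n.-tuple mR) : n.+1.-tuple mR :=
  [tuple of u.1 :: u.2].

Lemma measurable_cons_pair n :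
  measurable_fun [set: mR * n.-tuple mR] (@cons_pair n).
Proof.
exact: (measurable_cons measurable_fst measurable_snd).
Qed.

Section step.
Variables (n : nat) (m : {sigma_finite_measure set (n.-tuple mR) -> \bar R}).

Definition lebesgue_cons : set (n.+1.-tuple mR) -> \bar R :=
  pushforward (lebesgue_measure \x m)%E (@cons_pair n).

Let lebesgue_cons0 : lebesgue_cons set0 = 0%E.
Proof. by rewrite /lebesgue_cons /pushforward preimage_set0 measure0. Qed.

Let lebesgue_cons_ge0 A : (0 <= lebesgue_cons A)%E.
Proof. by rewrite /lebesgue_cons /pushforward; exact: measure_ge0. Qed.

Let lebesgue_cons_sigma_additive : semi_sigma_additive lebesgue_cons.
Proof.
move=> F mF tF mUF; rewrite /lebesgue_cons /pushforward preimage_bigcup.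
apply: measure_semi_sigma_additive.
- by move=> k; rewrite -[X in measurable X]setTI; exact: measurable_cons_pair.
- apply/trivIsetP => /= i j _ _ ij; rewrite -preimage_setI.
  by move/trivIsetP : tF => /(_ _ _ _ _ ij) ->//; rewrite preimage_set0.
- rewrite -preimage_bigcup -[X in measurable X]setTI.
  exact: measurable_cons_pair.
Qed.

HB.instance Definition _ := isMeasure.Build _ _ _ lebesgue_cons
  lebesgue_cons0 lebesgue_cons_ge0 lebesgue_cons_sigma_additive.

Let lebesgue_cons_sigma_finite : sigma_finite setT lebesgue_cons.
Proof.
have /sigma_finiteP[F [TF ndF Foo]] := sigma_finiteT (@lebesgue_measure R).
have /sigma_finiteP[G [TG ndG Goo]] := sigma_finiteT m.
pose g (t : n.+1.-tuple mR) : mR * n.-tuple mR :=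
  (thead t, [tuple of behead t]).
have mg : measurable_fun setT g.
  apply/measurable_fun_pairP; split.
    exact: measurable_tnth.
  exact: measurable_behead.
have gK u : g (cons_pair u) = u.
  by case: u => x t; rewrite /g/cons_pair/=; congr pair; apply/val_inj.
exists (fun k => g @^-1` (F k `*` G k)).
  apply/seteqP; split=> // t _.
  have [i _ Fi] : (\bigcup_i F i) (g t).1 by rewrite -TF.
  have [j _ Gj] : (\bigcup_i G i) (g t).2 by rewrite -TG.
  exists (maxn i j) => //; split.
    by move: Fi; exact/subsetPset/ndF/leq_maxl.
  by move: Gj; exact/subsetPset/ndG/leq_maxr.
move=> k; have [mF Fk] := Foo k; have [mG Gk] := Goo k; split.
  by rewrite -[X in measurable X]setTI; apply: mg => //; exact: measurableX.
rewrite /lebesgue_cons /pushforward -comp_preimage.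
rewrite (_ : g \o _ = id); last by apply/funext => u /=.
rewrite preimage_id product_measure1E//.
by rewrite lte_mul_pinfty// ge0_fin_numE.
Qed.

HB.instance Definition _ := Measure_isSigmaFinite.Build _ _ _ lebesgue_cons
  lebesgue_cons_sigma_finite.

End step.

Fixpoint lebesgue_tuple (n : nat) :
    {sigma_finite_measure set (n.-tuple mR) -> \bar R} :=
  match n with
  | 0%N => dirac ([tuple] : 0.-tuple mR)
  | k.+1 => lebesgue_cons (lebesgue_tuple k)
  end.

End lebesgue_tuple.
Arguments lebesgue_tuple R n : clear implicits.

(* A parametric model is given by the densities p theta with respect to a     *)
(* dominating measure mu; the law of an observation is P_theta = p theta . mu, *)
(* so that E_theta[g] is the mu-integral of g * p theta.                       *)
Section fisher.
Context {R : realType} {d : measure_display} {T : measurableType d}.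
Variables (mu : {measure set T -> \bar R}) (k : nat).
Variable p : 'cV[R]_k -> T -> R.

Definition expectation_at (theta : 'cV[R]_k) (g : T -> R) : R :=
  \int[mu]_x (g x * p theta x).

Definition score (theta : 'cV[R]_k) (x : T) : 'cV[R]_k :=
  \col_i 'D_(delta_mx i 0) (fun t : 'cV[R]_k => ln (p t x)) theta.

Definition fisher_information (theta : 'cV[R]_k) : 'M[R]_k :=
  \matrix_(i, j)
    expectation_at theta (fun x => score theta x i 0 * score theta x j 0).

End fisher.

(* J is written m.+1.  The 3J - 1 free parameters are stacked as a column of  *)
(* height J + J + (J - 1): first delta_1..delta_J (resp. d_1..d_J), then      *)
(* a_11..a_J1, then a_22..a_J2.  The entry a_12 = 0 is not a parameter: it is *)
(* the top block of loading2.                                                 *)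
Section parameters.
Context {R : realType} {m : nat}.
Implicit Type theta : 'cV[R]_(m.+1 + m.+1 + m).

Definition unique_variance theta : 'cV[R]_m.+1 := usubmx (usubmx theta).

Definition intercept theta : 'cV[R]_m.+1 := usubmx (usubmx theta).

Definition loading1 theta : 'cV[R]_m.+1 := dsubmx (usubmx theta).

Definition loading2 theta : 'cV[R]_m.+1 :=
  col_mx (0 : 'cV[R]_1) (dsubmx theta).

End parameters.

Definition mvnormal_pdf {R : realType} {n : nat} (Sigma : 'M[R]_n)
    (x : n.-tuple (measurableTypeR R)) : R :=
  let v : 'cV[R]_n := \col_i tnth x i in
  (Num.sqrt ((2 * pi) ^+ n * \det Sigma))^-1 *
  expR (- (v^T *m invmx Sigma *m v) 0 0 / 2).

Section two_factor_models.
Context {R : realType} {m : nat}.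
Implicit Type theta : 'cV[R]_(m.+1 + m.+1 + m).

Definition factor_cov theta : 'M[R]_m.+1 :=
  loading1 theta *m (loading1 theta)^T + loading2 theta *m (loading2 theta)^T
  + diag_mx (unique_variance theta)^T.

Definition factor_pdf theta (x : m.+1.-tuple (measurableTypeR R)) : R :=
  mvnormal_pdf (factor_cov theta) x.

Definition item_predictor theta (xi1 xi2 : R) (j : 'I_m.+1) : R :=
  intercept theta j 0 + loading1 theta j 0 * xi1 + loading2 theta j 0 * xi2.

Definition item_factor_pmf theta (x : m.+1.-tuple bool) : R :=
  \int[lebesgue_measure]_xi2 \int[lebesgue_measure]_xi1
    ((\prod_j (expR ((tnth x j)%:R * item_predictor theta xi1 xi2 j) /
               (1 + expR (item_predictor theta xi1 xi2 j)))) *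
     normal_pdf 0 1 xi1 * normal_pdf 0 1 xi2).

Definition factor_fisher theta : 'M[R]_(m.+1 + m.+1 + m) :=
  fisher_information (lebesgue_tuple R m.+1) factor_pdf theta.

Definition item_factor_fisher theta : 'M[R]_(m.+1 + m.+1 + m) :=
  fisher_information (@counting (m.+1.-tuple bool) R) item_factor_pmf theta.

End two_factor_models.

(* Main.v *)
Require Import Defs.
From mathcomp Require Import all_boot all_order all_algebra.
From mathcomp Require Import all_classical all_reals all_analysis.
From mathcomp Require Import measurable_realfun normal_distribution lra ring.

Set Implicit Arguments.
Unset Strict Implicit.
Unset Printing Implicit Defensive.

Import Order.TTheory GRing.Theory Num.Theory.
Import numFieldNormedType.Exports.

Local Open Scope classical_set_scope.
Local Open Scope ring_scope.

(** In both models the law of an observation depends on the second loading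
    vector a_2 only up to sign: Sigma contains a_2 through a_2 a_2^T, and in the
    item model the sign of a_2 is absorbed by xi_2 |-> - xi_2, under which the
    law of xi_2 is invariant.  When the true a_2 vanishes, moving a single free
    loading a_j2 therefore gives a density that is an even function of the
    displacement ([factor_pdf_even], [item_factor_pmf_even]), so the score in
    that coordinate is identically zero ([derive_even]) and the information
    matrix has a zero row ([fisher_information_zero_score]).

    For J = 1 there is no free entry of a_2.  The model has then two
    parameters, while its law is determined by one real number: the variance
    a_11 ^ 2 + delta_1, respectively the probability that the item equals 1.  By
    the chain rule the score is h(x) c with a constant vector c, and the
    information matrix, a multiple of c c^T, has rank at most 1
    ([fisher_information_proportional_score]).

    The score of the item model is a derivative of an integral depending on
    parameters, but the integral never has to be differentiated.  The derivative
    'D_v f a is a limit, which is 0 by convention when it does not exist.  The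
    rule for even functions and, for an outer function with a derivable inverse,
    the chain rule ([derive_comp_invertible]) hold under this convention with no
    derivability assumption on the density. *)

(** * Directional derivatives of real functions *)

Section directional_derivative.
Context {R : realType} {V : normedModType R}.
Implicit Types (f : V -> R) (a v : V).

Lemma derive_along_line f a v :
  'D_v f a = 'D_1 (fun h : R => f (h *: v + a)) 0.
Proof.
rewrite /derive; set d := (X in lim (X @ _) = _).
set d' := (X in _ = lim (X @ _)).
suff -> : d = d' by [].
by apply/funext => h; rewrite /d /d' /= addr0 scale0r add0r [_%:A]mulr1.
Qed.

(** The limit of a divergent filter is the default point of R, which is 0. *)
Lemma derive_not_derivable f a v : ~ derivable f a v -> 'D_v f a = 0.
Proof. exact: dvgP. Qed.

(** If the derivative exists, reversing the direction both preserves it and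
    changes its sign. *)
Lemma derive_even f a v :
  (forall h, f (h *: v + a) = f (- h *: v + a)) -> 'D_v f a = 0.
Proof.
move=> fE; have [df|/derive_not_derivable//] := pselect (derivable f a v).
rewrite derive_along_line; set g := fun h : R => f (h *: v + a).
have dg : is_derive (0 : R) 1 g ('D_1 g 0).
  exact/derivableP/((derivable1P f a v).1 df).
have dNg : is_derive (0 : R) 1 (g \o -%R) ('D_1 g 0 * - 1).
  by apply: is_derive1_comp; rewrite oppr0.
have gE : g \o -%R = g by apply/funext => h; rewrite /g /= [RHS]fE.
have := @derive_val _ _ _ _ _ _ _ dNg; rewrite gE => gN.
lra.
Qed.

Lemma derive_comp (phi : R -> R) f a v c :
  is_derive (f a) 1 phi c -> derivable f a v ->
  is_derive a v (phi \o f) (c * 'D_v f a).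
Proof.
move=> dphi df; set g := fun h : R => f (h *: v + a).
have dg : is_derive (0 : R) 1 g ('D_v f a).
  by rewrite derive_along_line; exact/derivableP/((derivable1P f a v).1 df).
have dphi' : is_derive (g 0) 1 phi c by rewrite /g scale0r add0r.
have dc := @is_derive1_comp _ phi g 0 c _ dphi' dg.
split; first by apply/derivable1P; exact: (@ex_derive _ _ _ _ _ _ _ dc).
by rewrite derive_along_line; exact: (@derive_val _ _ _ _ _ _ _ dc).
Qed.

(** Derivability of [phi \o f] passes back to [f] through [psi], so that both
    sides are 0 as soon as one of the two derivatives does not exist. *)
Lemma derive_comp_invertible (phi psi : R -> R) f a v c :
  is_derive (f a) 1 phi c -> derivable psi (phi (f a)) 1 ->
  (forall t, psi (phi (f t)) = f t) ->
  'D_v (phi \o f) a = c * 'D_v f a.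
Proof.
move=> dphi dpsi psiK.
have [df|ndf] := pselect (derivable f a v).
  by have /(@derive_val _ _ _ _ _ _ _) := derive_comp dphi df.
rewrite (derive_not_derivable ndf) mulr0; apply: derive_not_derivable.
apply: contra_not ndf => dphif.
have -> : f = psi \o (phi \o f) by apply/funext => t /=; rewrite psiK.
exact: (@ex_derive _ _ _ _ _ _ _ (derive_comp (derivableP dpsi) dphif)).
Qed.

End directional_derivative.

(** * Singular information matrices *)

Section singular_information.
Context {R : realType} {d : measure_display} {T : measurableType d}.
Variables (mu : {measure set T -> \bar R}) (k : nat).
Variable p : 'cV[R]_k -> T -> R.
Implicit Types theta : 'cV[R]_k.

Lemma fisher_information_zero_score theta i :
  (forall x, score p theta x i 0 = 0) ->
  fisher_information mu p theta \notin unitmx.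
Proof.
move=> s0; rewrite unitmxE (expand_det_row _ i) big1 ?unitr0// => j _.
rewrite mxE /expectation_at.
under eq_Rintegral do rewrite s0 !mul0r.
by rewrite Rintegral_cst// mul0r mul0r.
Qed.

(** The sign of [f] makes the rule hold without integrability: if the integral
    of [f] is +oo, then both sides are 0, because [fine] sends the infinities
    to 0. *)
Lemma ge0_RintegralZl (f : T -> R) (r : R) :
  measurable_fun setT f -> (forall x, 0 <= f x) ->
  \int[mu]_x (r * f x) = r * \int[mu]_x f x.
Proof.
move=> mf f0.
have Hp s : 0 <= s -> \int[mu]_x (s * f x) = s * \int[mu]_x f x.
  rewrite le_eqVlt => /predU1P[<-|s0].
    under eq_Rintegral do rewrite mul0r.
    by rewrite Rintegral_cst// !mul0r.
  rewrite /Rintegral; under eq_integral do rewrite EFinM.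
  rewrite ge0_integralZl_EFin//; [|by move=> x _; rewrite lee_fin| |exact: ltW].
    have : (0 <= \int[mu]_x (f x)%:E)%E.
      by apply: integral_ge0 => x _; rewrite lee_fin.
    case: (\int[mu]_x _)%E => [y|_|//]; first by [].
    by rewrite mulry gtr0_sg// mul1e /= mulr0.
  exact/measurable_EFinP.
have [/Hp//|r0] := leP 0 r.
transitivity (- \int[mu]_x (- r * f x)).
  rewrite /Rintegral -fineN; congr fine.
  rewrite -integral_ge0N; last first.
    by move=> x _; rewrite lee_fin mulr_ge0// oppr_ge0 ltW.
  by apply: eq_integral => x _; rewrite -EFinN mulNr opprK.
by rewrite Hp ?oppr_ge0 1?ltW// mulNr opprK.
Qed.

(** The information matrix is [(\int h ^+ 2 * p) *: (c *m c^T)], of rank at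
    most 1. *)
Lemma fisher_information_proportional_score theta (c : 'cV[R]_k) (h : T -> R) :
  (1 < k)%N ->
  measurable_fun setT h -> measurable_fun setT (p theta) ->
  (forall x, 0 <= p theta x) ->
  (forall x, score p theta x = h x *: c) ->
  fisher_information mu p theta \notin unitmx.
Proof.
move=> k1 mh mp p0 sE.
have IE : fisher_information mu p theta =
    c *m ((\int[mu]_x (h x ^+ 2 * p theta x)) *: c^T).
  apply/matrixP => i j; rewrite !mxE big_ord1 !mxE /expectation_at.
  transitivity (\int[mu]_x (c i 0 * c j 0 * (h x ^+ 2 * p theta x))).
    by apply: eq_Rintegral => x _; rewrite sE !mxE; ring.
  rewrite ge0_RintegralZl; last 2 first.
    by apply: measurable_funM => //; exact: measurable_funX.
    by move=> x; rewrite mulr_ge0// sqr_ge0.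
  by rewrite -mulrA; congr *%R; rewrite mulrC.
apply: contraL k1 => /mxrank_unit rk; rewrite -leqNgt -[X in (X <= _)%N]rk IE.
exact: leq_trans (mxrankM_maxl _ _) (rank_leq_col _).
Qed.

End singular_information.

(** * The parameters along a line *)

Section parameter_lines.
Context {R : realType} {m : nat}.
Implicit Types theta v : 'cV[R]_(m.+1 + m.+1 + m).

Lemma unique_variance_line h v theta : unique_variance (h *: v + theta) =
  h *: unique_variance v + unique_variance theta.
Proof. by apply/matrixP => i j; rewrite !mxE. Qed.

Lemma intercept_line h v theta : intercept (h *: v + theta) =
  h *: intercept v + intercept theta.
Proof. exact: unique_variance_line. Qed.

Lemma loading1_line h v theta : loading1 (h *: v + theta) =
  h *: loading1 v + loading1 theta.
Proof. by apply/matrixP => i j; rewrite !mxE. Qed.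

Lemma loading2_line h v theta : loading2 (h *: v + theta) =
  h *: loading2 v + loading2 theta.
Proof.
apply/colP => j; rewrite !mxE.
by case: splitP => k _; rewrite !mxE ?mulr0 ?addr0.
Qed.

Lemma loading2_eq0 theta :
  (forall j : 'I_m.+1, (0 < j)%N -> loading2 theta j 0 = 0) ->
  loading2 theta = 0.
Proof.
move=> H; apply/colP => j; rewrite [RHS]mxE.
have [/H//|] := ltnP 0 j; rewrite leqn0 => /eqP j0.
rewrite mxE; case: splitP => [k _|k jk]; first by rewrite mxE.
by move: j0; rewrite jk.
Qed.

Lemma usubmx_delta_rshift (i : 'I_m) :
  usubmx (delta_mx (rshift _ i) 0) = 0 :> 'cV[R]_(m.+1 + m.+1).
Proof.
by apply/colP => j; rewrite !mxE eq_lrshift.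
Qed.

End parameter_lines.

(** * The Gaussian density *)

Section gaussian.
Context {R : realType}.

(** On the line through [theta], a_2 is [h *: loading2 v], and the covariance
    matrix is quadratic in it. *)
Lemma factor_pdf_even m (theta : 'cV[R]_(m.+1 + m.+1 + m)) v x h :
  unique_variance v = 0 -> loading1 v = 0 -> loading2 theta = 0 ->
  factor_pdf (h *: v + theta) x = factor_pdf (- h *: v + theta) x.
Proof.
move=> uv0 lv0 l20; rewrite /factor_pdf.
suff -> : factor_cov (h *: v + theta) = factor_cov (- h *: v + theta) by [].
rewrite /factor_cov !unique_variance_line !loading1_line !loading2_line.
by rewrite uv0 lv0 l20 !scaler0 !addr0 !scaleNr linearN /= mulNmx mulmxN opprK.
Qed.

Definition variance1 (theta : 'cV[R]_(1 + 1 + 0)) : R := factor_cov theta 0 0.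

Lemma variance1E theta : variance1 theta =
  (loading1 theta 0 0) ^+ 2 + unique_variance theta 0 0.
Proof.
rewrite /variance1 /factor_cov !mxE !big_ord1 !mxE.
case: splitP => // j _; rewrite !mxE mul0r addr0 eqxx mulr1n; congr (_ * _ + _).
Qed.

Lemma variance1_gt0 theta : 0 < unique_variance theta 0 0 ->
  0 < variance1 theta.
Proof. by move=> u0; rewrite variance1E ltr_wpDl// sqr_ge0. Qed.

Lemma derivable_variance1 theta v : derivable variance1 theta v.
Proof.
apply: (derivable1P _ _ _).2.
have -> : (fun h : R => variance1 (h *: v + theta)) =
  (fun h => (h * loading1 v 0 0 + loading1 theta 0 0) ^+ 2 +
     (h * unique_variance v 0 0 + unique_variance theta 0 0)).
  apply/funext => h; rewrite variance1E.
  by rewrite loading1_line unique_variance_line !mxE.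
exact: ex_derive.
Qed.

Lemma factor_pdf1E theta x : factor_pdf theta x =
  (Num.sqrt (2 * pi * variance1 theta))^-1 *
  expR (- ((tnth x 0) ^+ 2 * (variance1 theta)^-1) / 2).
Proof.
rewrite /factor_pdf /mvnormal_pdf expr1 det_mx11 -/(variance1 theta).
congr (_ * expR (- _ / 2)).
rewrite [factor_cov theta]mx11_scalar -/(variance1 theta) invmx_scalar.
rewrite mul_mx_scalar -scalemxAl !mxE big_ord1 !mxE; ring.
Qed.

(** Near [s] the logarithm is
    [- (ln (2 * pi) + ln t) / 2 - x ^+ 2 / (2 * t)]; the split of the square
    root and of the product is valid only for [0 < t]. *)
Lemma is_derive_ln_normal (x s : R) : 0 < s ->
  is_derive s 1 (fun t => ln ((Num.sqrt (2 * pi * t))^-1 *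
                               expR (- (x ^+ 2 * t^-1) / 2)))
    (- s^-1 / 2 + x ^+ 2 * (s ^- 2 / 2)).
Proof.
move=> s0.
have p0 : 0 < 2 * pi :> R by rewrite mulr_gt0// pi_gt0.
have c0 (t : R) : 0 < t -> 0 < 2 * pi * t by move=> t0; exact: (mulr_gt0 p0).
apply: (@near_eq_is_derive _ _ _
    (fun t => - ((ln (2 * pi) + ln t) / 2) - x ^+ 2 / 2 * t^-1)).
  near=> t => /=; have t0 : 0 < t by near: t; exact: lt_nbhsr.
  have sq0 : 0 < Num.sqrt (2 * pi * t) by rewrite sqrtr_gt0 c0.
  rewrite [ln (_^-1 * _)]lnM ?posrE ?invr_gt0 ?expR_gt0// expRK lnV ?posrE//.
  have : ln (Num.sqrt (2 * pi * t) ^+ 2) = ln (2 * pi) + ln t.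
    by rewrite sqr_sqrtr ?ltW ?c0// lnM ?posrE.
  rewrite lnXn// => <-; rewrite mulr2n; lra.
have dV : is_derive s 1 (fun t : R => t^-1) (- s ^- 2).
  have sN0 : id s != 0 by rewrite gt_eqF.
  apply: (is_derive_eq (@is_deriveV R id s 1 1 sN0 (is_derive_id s 1))).
  exact: mulr1.
have dl := is_derive1_ln s0.
apply: is_derive_eq.
rewrite /GRing.scale/=.
lra.
Unshelve. all: by end_near. Qed.

End gaussian.

(** * The information matrix of the factor model *)

Section factor_model.
Context {R : realType}.

Lemma measurable_factor_pdf1 (theta : 'cV[R]_(1 + 1 + 0)) :
  measurable_fun setT (factor_pdf theta).
Proof.
rewrite (_ : factor_pdf theta = (fun y : R =>
  (Num.sqrt (2 * pi * variance1 theta))^-1 *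
  expR (- (y ^+ 2 * (variance1 theta)^-1) / 2)) \o (@tnth _ _)^~ 0); last first.
  by apply/funext => x; rewrite factor_pdf1E.
apply: measurableT_comp; last exact: measurable_tnth.
apply: measurable_funM => //; apply: measurableT_comp => //.
apply: measurable_funM => //; apply: measurableT_comp => //.
by apply: measurable_funM => //; exact: measurable_funX.
Qed.

(** The direction is that of a_22 when there are at least two variables;
    otherwise the density depends on the parameters through [variance1]. *)
Lemma factor_fisher_singular m (theta : 'cV[R]_(m.+1 + m.+1 + m)) :
  (forall j, 0 < unique_variance theta j 0) -> loading2 theta = 0 ->
  factor_fisher theta \notin unitmx.
Proof.
case: m theta => [|m] theta u0 l20; last first.
  apply: (@fisher_information_zero_score _ _ _ _ _ _ _ (rshift _ 0)) => x.
  rewrite mxE.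
  apply: derive_even => h.
  rewrite -(@factor_pdf_even _ _ _ (delta_mx (rshift _ 0) 0) x h) //.
    by rewrite /unique_variance usubmx_delta_rshift linear0.
  by rewrite /loading1 usubmx_delta_rshift linear0.
have s0 := variance1_gt0 (u0 0).
pose s := variance1 theta.
pose c : 'cV[R]_(1 + 1 + 0) := \col_i 'D_(delta_mx i 0) variance1 theta.
pose h (x : 1.-tuple (measurableTypeR R)) : R :=
  - s^-1 / 2 + tnth x 0 ^+ 2 * (s ^- 2 / 2).
apply: (@fisher_information_proportional_score _ _ _ (lebesgue_tuple R 1)
  _ (@factor_pdf R 0) theta c h) => //.
- apply: measurable_funD => //; apply: measurable_funM => //.
  by apply: measurable_funX; exact: measurable_tnth.
- exact: measurable_factor_pdf1.
- by move=> x; rewrite factor_pdf1E mulr_ge0 ?expR_ge0// invr_ge0 sqrtr_ge0.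
- move=> x; apply/colP => i; rewrite !mxE.
  under eq_fun do rewrite factor_pdf1E.
  have dl := is_derive_ln_normal (tnth x 0) s0.
  have dv := @derivable_variance1 R theta (delta_mx i 0).
  exact: (@derive_val _ _ _ _ _ _ _ (derive_comp dl dv)).
Qed.

End factor_model.

(** * The item response probabilities *)

Section item_factor_model.
Context {R : realType}.
Local Notation mu := (@lebesgue_measure R).

Definition item_response (b : bool) (t : R) : R :=
  expR (b%:R * t) / (1 + expR t).

Lemma item_response_gt0 b t : 0 < item_response b t.
Proof. by rewrite divr_gt0 ?expR_gt0// addr_gt0 ?expR_gt0. Qed.

Lemma item_responseD t : item_response true t + item_response false t = 1.
Proof.
by rewrite /item_response mul1r mul0r expR0 -mulrDl addrC divff.
Qed.

Lemma measurable_item_response b : measurable_fun setT (item_response b).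
Proof.
apply: continuous_measurable_fun => t; apply: cvgM.
  apply: (cvg_comp (fun t => b%:R * t)); last exact: continuous_expR.
  by apply: cvgM; [exact: cvg_cst|exact: cvg_id].
apply: cvgV; first by rewrite gt_eqF// addr_gt0 ?expR_gt0.
by apply: cvgD; [exact: cvg_cst|exact: continuous_expR].
Qed.

(** Lebesgue measure is its own image under negation. *)
Lemma ge0_Rintegral_comp_opp (f : R -> R) :
  measurable_fun setT f -> (forall t, 0 <= f t) ->
  \int[mu]_t f (- t) = \int[mu]_t f t.
Proof.
move=> mf f0; rewrite /Rintegral; congr fine.
transitivity (\int[pushforward mu (-%R : R -> measurableTypeR R)]_t (f t)%:E)%E.
  rewrite ge0_integral_pushforward//; last 2 first.
    exact/measurable_EFinP.
    by move=> t _; rewrite lee_fin.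
by apply: eq_measure_integral => A mA _; exact: lebesgue_measureN.
Qed.

(** Replacing xi_2 by [- xi_2] turns the predictor at [h *: v + theta] into the
    one at [- h *: v + theta].  The measurability of the inner integral in xi_2,
    which the change of variable needs, comes from Tonelli's theorem. *)
Lemma item_factor_pmf_even m (theta : 'cV[R]_(m.+1 + m.+1 + m)) v x h :
  intercept v = 0 -> loading1 v = 0 -> loading2 theta = 0 ->
  item_factor_pmf (h *: v + theta) x = item_factor_pmf (- h *: v + theta) x.
Proof.
move=> iv0 lv0 l20.
pose F (t u : R) : R := (\prod_j item_response (tnth x j)
  (item_predictor (h *: v + theta) u t j)) *
  normal_pdf 0 1 u * normal_pdf 0 1 t.
have F0 t u : 0 <= F t u.
  rewrite mulr_ge0 ?normal_pdf_ge0// mulr_ge0 ?normal_pdf_ge0//.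
  by apply: prodr_ge0 => j _; rewrite ltW ?item_response_gt0.
have mF : measurable_fun setT (fun tu : R * R => F tu.1 tu.2).
  apply: measurable_funM; last first.
    by apply: measurableT_comp => //; exact: measurable_normal_pdf.
  apply: measurable_funM; last first.
    by apply: measurableT_comp => //; exact: measurable_normal_pdf.
  apply: measurable_prod => j _.
  apply: measurableT_comp; first exact: measurable_item_response.
  by do ![apply: measurable_funD => //|apply: measurable_funM => //].
have mIF : measurable_fun setT (fun t => \int[mu]_u F t u).
  apply: measurableT_comp => //.
  apply: (measurable_fun_fubini_tonelli_F (m2 := mu)
    (fun tu => (F tu.1 tu.2)%:E)); first exact/measurable_EFinP.
  by move=> tu; rewrite lee_fin.
transitivity (\int[mu]_t \int[mu]_u F t u); first by [].
rewrite (esym (ge0_Rintegral_comp_opp mIF _)); last first.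
  by move=> t; apply: Rintegral_ge0.
apply: eq_Rintegral => t _; apply: eq_Rintegral => u _.
have -> : normal_pdf 0 1 t = normal_pdf 0 1 (- t) :> R.
  by rewrite !normal_pdfE ?oner_eq0// /normal_fun !subr0 sqrrN.
rewrite /F; congr (_ * _ * _); apply: eq_bigr => j _.
rewrite /item_predictor !intercept_line !loading1_line !loading2_line.
by rewrite iv0 lv0 l20 !scaler0 !add0r !addr0 !mxE mulNr mulrN mulNr.
Qed.

End item_factor_model.

(** * The information matrix of the item model *)

Section single_item.
Context {R : realType}.
Local Notation mu := (@lebesgue_measure R).

Definition marginal_response (b : bool) (d a : R) : R :=
  \int[mu]_u (item_response b (d + a * u) * normal_pdf 0 1 u).

(** The response probability is at most 1, so the normal density dominates. *)
Lemma integrable_marginal_response b d a :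
  mu.-integrable setT
    (EFin \o (fun u => item_response b (d + a * u) * normal_pdf 0 1 u)).
Proof.
have mr : measurable_fun setT (fun u => item_response b (d + a * u)).
  apply: measurableT_comp; first exact: measurable_item_response.
  by apply: measurable_funD => //; exact: measurable_funM.
apply: (le_integrable measurableT _ _ (integrable_normal_pdf 0 1)).
  apply/measurable_EFinP; apply: measurable_funM => //.
  exact: measurable_normal_pdf.
move=> u _ /=; rewrite lee_fin !ger0_norm ?normal_pdf_ge0//; last first.
  by rewrite mulr_ge0 ?normal_pdf_ge0// ltW ?item_response_gt0.
rewrite ler_piMl ?normal_pdf_ge0// -(item_responseD (d + a * u)).
by case: b {mr}; rewrite ?lerDl ?lerDr ltW ?item_response_gt0.
Qed.

Lemma marginal_responseD d a :
  marginal_response true d a + marginal_response false d a = 1.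
Proof.
rewrite -RintegralD//; try exact: integrable_marginal_response.
transitivity (\int[mu]_u (normal_pdf 0 1 u : R)).
  by apply: eq_Rintegral => u _; rewrite -mulrDl item_responseD mul1r.
by rewrite /Rintegral integral_normal_pdf.
Qed.

(** A nonnegative function of integral zero vanishes almost everywhere; this one
    vanishes nowhere, and the line has infinite measure. *)
Lemma marginal_response_gt0 b d a : 0 < marginal_response b d a.
Proof.
set f := fun u : R => item_response b (d + a * u) * normal_pdf 0 1 u.
have f0 u : 0 < f u.
  rewrite mulr_gt0 ?item_response_gt0// normal_pdfE ?oner_eq0//.
  by rewrite mulr_gt0 ?expR_gt0// normal_peak_gt0 ?oner_eq0.
have If := integrable_marginal_response b d a.
have ge0 : 0 <= marginal_response b d a.
  by apply: Rintegral_ge0 => u _; exact/ltW/f0.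
rewrite lt_neqAle ge0 andbT eq_sym; apply/eqP => I0.
have mf : measurable_fun setT (EFin \o f) by case/integrableP: If.
have : (\int[mu]_u `|(EFin \o f) u|)%E = 0%E.
  transitivity (\int[mu]_u (f u)%:E)%E.
    by apply: eq_integral => u _ /=; rewrite ger0_norm// ltW.
  rewrite -[LHS]fineK; last exact: integrable_fin_num.
  by rewrite [X in X%:E]I0.
move=> /(ae_eq_integral_abs mu measurableT mf)[A [mA muA0 /= sub]].
have AT : A = setT.
  apply/seteqP; split => // u _; apply: sub => /=.
  by move=> /(_ Logic.I) [] /eqP; rewrite gt_eqF.
have := lebesgue_measure_itv (`]-oo, +oo[ : interval R).
by rewrite set_itvNyy -AT muA0.
Qed.

(** The only second loading is the fixed a_12 = 0, so xi_2 integrates out. *)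
Lemma item_factor_pmf1E (theta : 'cV[R]_(1 + 1 + 0)) x :
  item_factor_pmf theta x =
  marginal_response (tnth x 0) (intercept theta 0 0) (loading1 theta 0 0).
Proof.
set M := marginal_response _ _ _.
transitivity (\int[mu]_t (M * normal_pdf 0 1 t)).
  apply: eq_Rintegral => t _.
  rewrite -RintegralZr//; last exact: integrable_marginal_response.
  apply: eq_Rintegral => u _; rewrite big_ord1 /item_predictor.
  rewrite [X in _ + X * t]mxE; case: splitP => // j _.
  by rewrite [X in _ + X * t]mxE mul0r addr0 ord1.
rewrite RintegralZl//; last exact: integrable_normal_pdf.
by rewrite /Rintegral integral_normal_pdf mulr1.
Qed.

(** The two log-probabilities are [ln (f t)] and [ln (1 - f t)]; both [ln] and
    [fun y => ln (1 - y)] have smooth inverses, so that their scores are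
    multiples of the same vector of derivatives of [f], whether or not these
    exist. *)
Lemma score_single_item (theta : 'cV[R]_(1 + 1 + 0)) x :
  let f t := marginal_response true (intercept t 0 0) (loading1 t 0 0) in
  score (@item_factor_pmf R 0) theta x =
  (if tnth x 0 then (f theta)^-1 else - (1 - f theta)^-1) *:
    \col_i 'D_(delta_mx i 0) f theta.
Proof.
move=> f; apply/colP => i; rewrite !mxE.
under eq_fun do rewrite item_factor_pmf1E.
have f_gt0 t : 0 < f t by exact: marginal_response_gt0.
have fE t :
    marginal_response false (intercept t 0 0) (loading1 t 0 0) = 1 - f t.
  rewrite -(marginal_responseD (intercept t 0 0) (loading1 t 0 0)).
  by rewrite addrC addKr.
have f_lt1 t : 0 < 1 - f t by rewrite -fE marginal_response_gt0.
case: (tnth x 0).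
  apply: (@derive_comp_invertible _ _ (@ln R) expR f).
  - exact: is_derive1_ln.
  - exact: ex_derive.
  - by move=> t; rewrite lnK// posrE.
under eq_fun do rewrite fE.
apply: (@derive_comp_invertible _ _ (fun y : R => ln (1 - y))
  (fun z => 1 - expR z) f).
- have dl := is_derive1_ln (f_lt1 theta).
  have d1 : is_derive (f theta) 1 (fun y : R => 1 - y) (- 1).
    by apply: is_derive_eq; rewrite /GRing.scale/=; lra.
  have := @is_derive1_comp R (@ln R) (fun y => 1 - y) (f theta) _ _ dl d1.
  by rewrite mulrN1.
- exact: ex_derive.
- by move=> t; rewrite lnK ?posrE// opprB addrC subrK.
Qed.

(** The direction is that of a_22 when there are at least two items; otherwise
    the two scores are collinear. *)
Lemma item_factor_fisher_singular m (theta : 'cV[R]_(m.+1 + m.+1 + m)) :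
  loading2 theta = 0 -> item_factor_fisher theta \notin unitmx.
Proof.
case: m theta => [|m] theta l20; last first.
  apply: (@fisher_information_zero_score _ _ _ _ _ _ _ (rshift _ 0)) => x.
  rewrite mxE.
  apply: derive_even => h.
  rewrite -(@item_factor_pmf_even _ _ _ (delta_mx (rshift _ 0) 0) x h) //.
    by rewrite /intercept usubmx_delta_rshift linear0.
  by rewrite /loading1 usubmx_delta_rshift linear0.
have mbool (g : bool -> R) :
    measurable_fun setT (fun x : 1.-tuple bool => g (tnth x 0)).
  by apply: (@measurableT_comp _ _ _ _ _ _ g) => //; exact: measurable_tnth.
pose f (t : 'cV[R]_(1 + 1 + 0)) : R :=
  marginal_response true (intercept t 0 0) (loading1 t 0 0).
apply: (@fisher_information_proportional_score _ _ _
  (@counting (1.-tuple bool) R) _ (@item_factor_pmf R 0) theta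
  (\col_i 'D_(delta_mx i 0) f theta)
  (fun x => if tnth x 0 then (f theta)^-1 else - (1 - f theta)^-1)) => //.
- exact: (mbool (fun b : bool => if b then _ else _)).
- rewrite (_ : item_factor_pmf theta = fun x => marginal_response (tnth x 0)
    (intercept theta 0 0) (loading1 theta 0 0)); last first.
    by apply/funext => x; rewrite item_factor_pmf1E.
  exact: (mbool (fun b => marginal_response b _ _)).
- by move=> x; rewrite item_factor_pmf1E ltW// marginal_response_gt0.
- by move=> x; exact: score_single_item.
Qed.

End single_item.

Theorem lemma1 (R : realType) (m : nat) :
  (forall theta : 'cV[R]_(m.+1 + m.+1 + m),
     (forall j : 'I_m.+1, 0 < unique_variance theta j 0) ->
     (forall j : 'I_m.+1, (0 < j)%N -> loading2 theta j 0 = 0) ->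
     factor_fisher theta \notin unitmx)
  /\
  (forall theta : 'cV[R]_(m.+1 + m.+1 + m),
     (forall j : 'I_m.+1, (0 < j)%N -> loading2 theta j 0 = 0) ->
     item_factor_fisher theta \notin unitmx).
Proof.
split=> [theta u0 /loading2_eq0|theta /loading2_eq0].
  exact: factor_fisher_singular.
exact: item_factor_fisher_singular.
Qed.
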